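(* Let $X$ be a set, let $\Omega$ be an algebra of subsets of $X$, let $E$ be a Dedekind complete Banach lattice, let $\mu:\Omega\to\mathcal L_{\mathrm r}(E)^+$ be a map such that $\mu(\emptyset)=0$, and let $(\Delta_n)_{n=1}^\infty\subseteq\Omega$ be such that $\bigcup_{n=1}^\infty\Delta_n\in\Omega$. (1) If $\mu\big(\bigcup_{n=1}^\infty\Delta_n\big)x=\sum_{n=1}^\infty\mu(\Delta_n)x$ in the norm topology on $E$ for all $x\in E$, then $\mu\big(\bigcup_{n=1}^\infty\Delta_n\big)=\bigvee_{N=1}^\infty\sum_{n=1}^N\mu(\Delta_n)$ in $\mathcal L_{\mathrm r}(E)$. (2) If $\mu\big(\bigcup_{n=1}^\infty\Delta_n\big)=\bigvee_{N=1}^\infty\sum_{n=1}^N\mu(\Delta_n)$ in $\mathcal L_{\mathrm r}(E)$ and if the norm on $E$ is $\sigma$-order continuous, then $\mu\big(\bigcup_{n=1}^\infty\Delta_n\big)x=\sum_{n=1}^\infty\mu(\Delta_n)x$ in the norm topology of $E$ for all $x\in E$.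
   Context: $\mathcal L_{\mathrm r}(E)$ is the space of regular operators on $E$ (differences of positive linear operators $E\to E$), partially ordered by the cone $\mathcal L_{\mathrm r}(E)^+$ of positive operators ($T\ge0$ iff $T(E^+)\subseteq E^+$). Dedekind complete means that every non-empty subset that is bounded from above has a supremum. The norm on $E$ is $\sigma$-order continuous if $\|x_n\|\to0$ for every sequence $x_n\downarrow0$ in $E$. The symbol $\bigvee$ denotes the supremum in $\mathcal L_{\mathrm r}(E)$; an equality with it asserts that the supremum exists and equals the other side. *)

(* Defs.v *)
From HB Require Import structures.
From mathcomp Require Import all_boot all_order all_algebra.
From mathcomp Require Import all_classical all_reals all_analysis.

Set Implicit Arguments.
Unset Strict Implicit.
Unset Printing Implicit Defensive.

Import Order.TTheory GRing.Theory Num.Theory.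
Import numFieldNormedType.Exports.

Local Open Scope classical_set_scope.
Local Open Scope ring_scope.

(* A packed record rather than an HB structure: Order.Lattice and NormedModule
   cannot be joined after realDomainType, which inherits from both. The carrier
   gets its library structures below. bl_join x (- x) is the absolute value of
   x in the vector lattice; `|x| : R is its norm. *)
Record banachLatticeType (R : realType) := BanachLattice {
  bl_normed : completeNormedModType R ;
  bl_le : rel bl_normed ;
  bl_join : bl_normed -> bl_normed -> bl_normed ;
  bl_meet : bl_normed -> bl_normed -> bl_normed ;
  bl_le_refl : reflexive bl_le ;
  bl_le_anti : antisymmetric bl_le ;
  bl_le_trans : transitive bl_le ;
  bl_leUx : forall x y z, bl_le (bl_join x y) z = bl_le x z && bl_le y z ;
  bl_lexI : forall x y z, bl_le x (bl_meet y z) = bl_le x y && bl_le x z ;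
  bl_le_add2r : forall z x y, bl_le x y -> bl_le (x + z) (y + z) ;
  bl_le_scale : forall (a : R) x, 0 <= a -> bl_le 0 x -> bl_le 0 (a *: x) ;
  bl_le_norm : forall x y,
    bl_le (bl_join x (- x)) (bl_join y (- y)) -> `|x| <= `|y| }.

Definition bl_sort (R : realType) (E : banachLatticeType R) : Type :=
  bl_normed E.
Coercion bl_sort : banachLatticeType >-> Sortclass.

Section banach_lattice_structure.
Context {R : realType} {E : banachLatticeType R}.

HB.instance Definition _ :=
  CompleteNormedModule.copy (bl_sort E) (bl_normed E).

HB.instance Definition _ := Order.Le_isPOrder.Build ring_display (bl_sort E)
  (@bl_le_refl R E) (@bl_le_anti R E) (@bl_le_trans R E).

HB.instance Definition _ :=
  Order.POrder_MeetJoin_isLattice.Build ring_display (bl_sort E)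
  (@bl_lexI R E) (@bl_leUx R E).

Lemma bl_lerD2r (z x y : E) : x <= y -> x + z <= y + z.
Proof. exact: bl_le_add2r. Qed.

Lemma bl_scaler_ge0 (a : R) (x : E) : 0 <= a -> 0 <= x -> 0 <= a *: x.
Proof. exact: bl_le_scale. Qed.

Lemma bl_ler_norm (x y : E) :
  Order.join x (- x) <= Order.join y (- y) -> `|x| <= `|y|.
Proof. exact: bl_le_norm. Qed.

End banach_lattice_structure.

Definition dedekind_complete d (T : porderType d) : Prop :=
  forall A : set T, A !=set0 -> has_ubound A -> exists s, supremums A s.

Definition sigma_order_continuous_norm (R : realType)
    (E : banachLatticeType R) : Prop :=
  forall u : E^nat, nonincreasing_seq u -> infimums (range u) 0 ->
    `|u n| @[n --> \oo] --> (0 : R).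

Definition setalgebra (X : Type) (G : set (set X)) : Prop :=
  [/\ G set0, setU_closed G & setC_closed G].

Section regular_operators.
Context {R : realType} {E : banachLatticeType R}.

Definition positive_op : set (E -> E) :=
  [set T : E -> E | linear T /\ forall x : E, 0 <= x -> 0 <= T x].

Definition regular_op : {pred E -> E} :=
  mem [set T : E -> E | exists T1 T2,
    [/\ positive_op T1, positive_op T2 & T = T1 - T2]].

Lemma bl_addr_ge0 (x y : E) : 0 <= x -> 0 <= y -> 0 <= x + y.
Proof.
by move=> x0 y0; rewrite (le_trans y0)// -{1}[y]add0r bl_lerD2r.
Qed.

Lemma bl_subr_ge0 (x y : E) : (0 <= y - x) = (x <= y).
Proof.
apply/idP/idP => h.
  by have := bl_lerD2r x h; rewrite add0r subrK.
by have := bl_lerD2r (- x) h; rewrite subrr.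
Qed.

Lemma bl_ge0_decomp (x : E) :
  exists p : E * E, [/\ 0 <= p.1, 0 <= p.2 & x = p.1 - p.2].
Proof.
exists (Order.join x 0, Order.join x 0 - x); split => /=.
- exact: leUr.
- by rewrite bl_subr_ge0 leUl.
- by rewrite opprB addrC subrK.
Qed.

Lemma positive_op0 : positive_op 0.
Proof. by split=> [a x y|x _]; rewrite ?fctE ?scaler0 ?addr0. Qed.

Lemma positive_opD T S : positive_op T -> positive_op S -> positive_op (T + S).
Proof.
move=> [lT pT] [lS pS]; split=> [a x y|x x0].
  by rewrite !addrfctE/= lT lS scalerDr addrACA.
by rewrite addrfctE/= bl_addr_ge0 ?pT ?pS.
Qed.

Lemma positive_opZ (a : R) T : 0 <= a -> positive_op T -> positive_op (a *: T).
Proof.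
move=> a0 [lT pT]; split=> [b x y|x x0].
  by rewrite !scalrfctE lT scalerDr !scalerA mulrC.
by rewrite scalrfctE bl_scaler_ge0 ?pT.
Qed.

Lemma regular_op_submod_closed : submod_closed regular_op.
Proof.
split=> [|a _ _ /set_mem[T1 [T2 [p1 p2 ->]]] /set_mem[S1 [S2 [q1 q2 ->]]]].
  apply/mem_set; exists 0, 0; rewrite subrr.
  by split=> //; exact: positive_op0.
apply/mem_set; have [a0|a0] := leP 0 a.
  exists (a *: T1 + S1), (a *: T2 + S2); split.
  - exact: positive_opD (positive_opZ a0 p1) q1.
  - exact: positive_opD (positive_opZ a0 p2) q2.
  - by rewrite scalerBr opprD addrACA.
have a0' : 0 <= - a by rewrite oppr_ge0 ltW.
exists ((- a) *: T2 + S1), ((- a) *: T1 + S2); split.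
- exact: positive_opD (positive_opZ a0' p2) q1.
- exact: positive_opD (positive_opZ a0' p1) q2.
- by rewrite opprD addrACA !scaleNr opprK scalerBr (addrC (a *: T1)).
Qed.

HB.instance Definition _ :=
  GRing.isSubmodClosed.Build R (E -> E) regular_op regular_op_submod_closed.

End regular_operators.

Record regop (R : realType) (E : banachLatticeType R) : Type :=
  RegOp { regop_fun :> E -> E ; regop_funP : regop_fun \in regular_op }.

Section regop_structure.
Context {R : realType} {E : banachLatticeType R}.

HB.instance Definition _ := [isSub for @regop_fun R E].
HB.instance Definition _ := [Choice of regop E by <:].
HB.instance Definition _ := [SubChoice_isSubLmodule of regop E by <:].

Lemma regop_linear (T : regop E) : linear T.
Proof.
case: T => T /= /set_mem[T1 [T2 [[l1 _] [l2 _] ->]]] a x y.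
by rewrite /= !fctE l1 l2 scalerBr opprD addrACA.
Qed.

HB.instance Definition _ (T : regop E) :=
  GRing.isLinear.Build R E E *:%R T (@regop_linear T).

Lemma regopB (T : regop E) (x y : E) : T (x - y) = T x - T y.
Proof. exact: (linearB T). Qed.

(* S <= T iff T - S maps the positive cone of E into itself *)
Definition regop_le (S T : regop E) : bool :=
  `[< forall x : E, 0 <= x -> 0 <= (T - S) x >].

Lemma regop_subE (S T : regop E) x : (T - S) x = T x - S x.
Proof. by []. Qed.

Lemma regop_le_refl : reflexive regop_le.
Proof. by move=> T; apply/asboolP => x _; rewrite regop_subE subrr. Qed.

Lemma regop_le_anti : antisymmetric regop_le.
Proof.
move=> S T /andP[/asboolP ST /asboolP TS]; apply: val_inj; apply/funext => x.
have eqp z : 0 <= z -> S z = T z.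
  move=> z0; apply/le_anti/andP; split.
    by have := ST z z0; rewrite regop_subE bl_subr_ge0.
  by have := TS z z0; rewrite regop_subE bl_subr_ge0.
have [[p n] /= [p0 n0 ->]] := bl_ge0_decomp x.
change (S (p - n) = T (p - n)).
by rewrite !regopB (eqp p p0) (eqp n n0).
Qed.

Lemma regop_le_trans : transitive regop_le.
Proof.
move=> T S U /asboolP ST /asboolP TU; apply/asboolP => x x0.
have := bl_addr_ge0 (TU x x0) (ST x x0).
by rewrite !regop_subE addrA subrK.
Qed.

HB.instance Definition _ := Order.Le_isPOrder.Build ring_display (regop E)
  regop_le_refl regop_le_anti regop_le_trans.

Lemma regop_leP (S T : regop E) :
  S <= T <-> (forall x : E, 0 <= x -> S x <= T x).
Proof.
split=> [/asboolP h x /h|h]; first by rewrite regop_subE bl_subr_ge0.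
by apply/asboolP => x /h; rewrite regop_subE bl_subr_ge0.
Qed.

Lemma regop_ge0P (T : regop E) : 0 <= T <-> positive_op T.
Proof.
split=> [/regop_leP h|[_ h]]; last by apply/regop_leP => x /h.
by split; [exact: regop_linear|move=> x /h].
Qed.

End regop_structure.

(* Main.v *)
Require Import Defs.
From HB Require Import structures.
From mathcomp Require Import all_boot all_order all_algebra.
From mathcomp Require Import all_classical all_reals all_analysis.

Set Implicit Arguments.
Unset Strict Implicit.
Unset Printing Implicit Defensive.

Import Order.TTheory GRing.Theory Num.Theory.
Import numFieldNormedType.Exports.

Local Open Scope classical_set_scope.
Local Open Scope ring_scope.

(** Put S N := \sum_(0 <= n < N.+1) mu (Delta n) and T := mu (\bigcup_n Delta n).
    As the values of mu are positive, S N x increases with N for every x >= 0.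

    Part (1) holds because the positive cone of a Banach lattice is norm closed
    ([closed_nonneg]): order inequalities pass to norm limits, so the norm limit
    of an increasing sequence is its supremum ([cvg_supremums]). This identifies
    T x, for every x >= 0, as the least upper bound of the S N x, and the order
    on operators is tested on such x.

    Part (2) needs the converse passage, from a supremum of operators to
    suprema of their values ([regop_supremums_apply]). For x >= 0 the S N x are
    bounded by T x, so Dedekind completeness gives them a supremum sigma x. It
    is additive and positively homogeneous in x because suprema of increasing
    sequences are, hence extends to a linear map V by differences. V is a
    regular operator dominating all S N, so T <= V, that is T x <= sigma x for
    x >= 0; the reverse inequality holds by definition of sigma. Thus T x - S N x
    decreases to 0, which under a sigma-order continuous norm means that S N x
    tends to T x in norm. Every vector is a difference of positive ones, and both
    sides are linear. *)

(** * Order and norm in a Banach lattice *)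

Section banach_lattice_lemmas.
Context {R : realType} {E : banachLatticeType R}.
Implicit Types x y z : E.

Lemma bl_lerD x y x' y' : x <= y -> x' <= y' -> x + x' <= y + y'.
Proof.
move=> xy xy'; apply: (le_trans (bl_lerD2r x' xy)).
by rewrite !(addrC y) bl_lerD2r.
Qed.

Lemma bl_lerBrD x y z : (x <= y - z) = (x + z <= y).
Proof. by rewrite -[LHS]bl_subr_ge0 -[RHS]bl_subr_ge0 opprD addrA addrAC. Qed.

Lemma bl_lerN x y : (- y <= - x) = (x <= y).
Proof. by rewrite -[LHS]bl_subr_ge0 opprK addrC bl_subr_ge0. Qed.

Lemma bl_lerZ (c : R) x y : 0 <= c -> x <= y -> c *: x <= c *: y.
Proof.
move=> c0 xy; rewrite -bl_subr_ge0 -scalerBr bl_scaler_ge0//.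
by rewrite bl_subr_ge0.
Qed.

Lemma bl_abs_ge0 x : 0 <= Order.join x (- x).
Proof.
set a := Order.join _ _.
have aa : 0 <= a + a by rewrite -(subrr x) bl_lerD ?leUl ?leUr.
have : 0 <= 2^-1 *: (a + a) by rewrite bl_scaler_ge0.
by rewrite -[a + a]mulr2n -[a *+ 2]scaler_nat scalerA mulVf ?scale1r.
Qed.

(** Since [- x <= y - x], the modulus of [x - y] dominates the negative part of
    [x]. Hence [x] can be approximated by positive vectors only if its negative
    part vanishes, which gives closedness of the cone. *)
Lemma norm_negpart_le x y : 0 <= y -> `|Order.join (- x) 0| <= `|x - y|.
Proof.
move=> y0; set n := Order.join _ _.
have n0 : 0 <= n by exact: leUr.
apply: bl_ler_norm; rewrite (join_l (y := - n)); last first.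
  by rewrite (le_trans _ n0)// -oppr0 bl_lerN.
rewrite leUx bl_abs_ge0 andbT.
apply: (le_trans _ (leUr _ _)).
by rewrite opprB -{1}[- x]add0r bl_lerD2r.
Qed.

Lemma closed_nonneg : closed [set x : E | 0 <= x].
Proof.
move=> x clx /=; rewrite -[x]opprK -oppr0 bl_lerN.
suff /eqP : `|Order.join (- x) 0| = 0.
  by rewrite normr_eq0 => /eqP <-; exact: leUl.
apply/eqP; rewrite eq_le normr_ge0 andbT.
apply/ler_addgt0Pr => e e0; rewrite add0r.
have [y [/= y0 xy]] := clx _ (nbhsx_ballx x _ e0).
rewrite (le_trans (norm_negpart_le x y0))// ltW//.
by move: xy; rewrite -ball_normE.
Qed.

Lemma cvg_bl_le (u v : E^nat) x y : u @ \oo --> x -> v @ \oo --> y ->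
  (\forall n \near \oo, u n <= v n) -> x <= y.
Proof.
move=> ux vy uv; rewrite -bl_subr_ge0.
apply: (closed_cvg _ closed_nonneg _ _ (cvgB vy ux)).
by apply: filterS uv => n; rewrite /= bl_subr_ge0.
Qed.

Lemma cvg_supremums (u : E^nat) x : nondecreasing_seq u ->
  u @ \oo --> x -> supremums (range u) x.
Proof.
move=> ndu ux; split=> [_ [n _ <-]|y uy].
- apply: cvg_bl_le (cvg_cst (u n)) ux _.
  by exists n => // m /=; exact: ndu.
- apply: cvg_bl_le ux (cvg_cst y) _.
  by apply: nearW => n; apply: uy; exists n.
Qed.

(** The converse of [cvg_supremums] under a sigma-order continuous norm, applied
    to the sequence [x - u n], which decreases to [0]. *)
Lemma supremums_cvg (u : E^nat) x : sigma_order_continuous_norm E ->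
  nondecreasing_seq u -> supremums (range u) x -> u @ \oo --> x.
Proof.
move=> ocE ndu [ux lx]; apply/cvgrPdist_le => e e0.
have : `|x - u n| @[n --> \oo] --> (0 : R).
  apply: (ocE (fun n => x - u n)) => [m n mn|].
    by rewrite ![x - _]addrC bl_lerD2r// bl_lerN ndu.
  split=> [_ [n _ <-]|y uy].
    by rewrite bl_subr_ge0; apply: ux; exists n.
  suff : x <= x - y by rewrite bl_lerBrD addrC -bl_lerBrD subrr.
  apply: lx => _ [n _ <-]; rewrite bl_lerBrD addrC -bl_lerBrD.
  by apply: uy; exists n.
move/cvgrPdist_le => /(_ e e0); apply: filterS => n.
by rewrite sub0r normrN normr_id.
Qed.

(** Monotonicity matters: an upper bound of the diagonal sums [u n + v n] must
    be compared with all [u n + v m], which are dominated by diagonal ones. *)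
Lemma supremumsD (u v : E^nat) x y :
  nondecreasing_seq u -> nondecreasing_seq v ->
  supremums (range u) x -> supremums (range v) y ->
  supremums (range (u \+ v)) (x + y).
Proof.
move=> ndu ndv [ux lx] [vy ly]; split=> [_ [n _ <-]|z uvz].
  by apply: bl_lerD; [apply: ux|apply: vy]; exists n.
rewrite -bl_lerBrD; apply: lx => _ [n _ <-].
rewrite bl_lerBrD addrC -bl_lerBrD; apply: ly => _ [m _ <-].
rewrite bl_lerBrD addrC.
apply: (@le_trans _ _ ((u \+ v) (maxn n m))); last by apply: uvz; eexists.
by apply: bl_lerD; [apply: ndu; exact: leq_maxl|apply: ndv; exact: leq_maxr].
Qed.

Lemma supremumsZ (c : R) (u : E^nat) x : 0 <= c ->
  supremums (range u) x -> supremums (range (fun n => c *: u n)) (c *: x).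
Proof.
move=> c0 [ux lx]; split=> [_ [n _ <-]|z cuz].
  by apply: bl_lerZ => //; apply: ux; exists n.
have [c_eq0|cn0] := eqVneq c 0.
  by rewrite c_eq0 scale0r -(scale0r (u 0)) -c_eq0; apply: cuz; exists 0.
rewrite -[z]scale1r -(divff cn0) -scalerA bl_lerZ//.
apply: lx => _ [n _ <-].
rewrite -[u n]scale1r -(mulVf cn0) -scalerA bl_lerZ ?invr_ge0//.
by apply: cuz; exists n.
Qed.

End banach_lattice_lemmas.

(** * Linear extension from the positive cone *)

Section cone_extension.
Context {R : realType} {E : banachLatticeType R}.
Variable sigma : E -> E.
Hypothesis sigmaD : forall x y : E, 0 <= x -> 0 <= y ->
  sigma (x + y) = sigma x + sigma y.
Hypothesis sigmaZ : forall (c : R) (x : E), 0 <= c -> 0 <= x ->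
  sigma (c *: x) = c *: sigma x.

Definition cone_extension (x : E) : E :=
  sigma (Order.join x 0) - sigma (Order.join x 0 - x).

(** Additivity makes the value independent of the decomposition: two
    decompositions [p - q = p' - q'] give [p + q' = p' + q]. *)
Lemma cone_extensionB (p q : E) : 0 <= p -> 0 <= q ->
  cone_extension (p - q) = sigma p - sigma q.
Proof.
move=> p0 q0; rewrite /cone_extension; set j := Order.join _ _.
have j0 : 0 <= j by exact: leUr.
have k0 : 0 <= j - (p - q) by rewrite bl_subr_ge0 leUl.
apply/eqP; rewrite subr_eq addrAC eq_sym subr_eq -!sigmaD//.
by rewrite opprB addrCA (addrC p) subrK.
Qed.

Lemma cone_extension_ge0 (x : E) : 0 <= x -> cone_extension x = sigma x.
Proof.
move=> x0; rewrite -{1}[x]subr0 cone_extensionB//.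
have -> : sigma 0 = 0 by rewrite -(scale0r (0 : E)) sigmaZ// !scale0r.
by rewrite subr0.
Qed.

Lemma cone_extension_linear : linear cone_extension.
Proof.
move=> c x y.
have [[p q] /= [p0 q0 ->]] := bl_ge0_decomp x.
have [[p' q'] /= [p'0 q'0 ->]] := bl_ge0_decomp y.
have posD (a : R) (z z' : E) : 0 <= a -> 0 <= z -> 0 <= z' ->
    0 <= a *: z + z'.
  by move=> *; rewrite bl_addr_ge0 ?bl_scaler_ge0.
have sigmaP (a : R) (z z' : E) : 0 <= a -> 0 <= z -> 0 <= z' ->
    sigma (a *: z + z') = a *: sigma z + sigma z'.
  by move=> *; rewrite sigmaD ?sigmaZ ?bl_scaler_ge0.
rewrite !cone_extensionB//.
have [c0|/ltW c0] := leP 0 c.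
  rewrite scalerBr addrACA -opprD cone_extensionB ?posD// !sigmaP//.
  by rewrite opprD addrACA -scalerBr.
(* a negative scalar exchanges the two terms of a decomposition *)
have nc0 : 0 <= - c by rewrite oppr_ge0.
rewrite -{1}[c]opprK scaleNr -scalerN opprB scalerBr addrACA -opprD.
rewrite cone_extensionB ?posD// !sigmaP//.
by rewrite opprD addrACA -scalerBr scaleNr -scalerN opprB.
Qed.

End cone_extension.

(** * Suprema of increasing sequences of regular operators *)

Section regular_operator_suprema.
Context {R : realType} {E : banachLatticeType R}.
Implicit Types S : (regop E)^nat.

Lemma regop_sum_apply (I : Type) (r : seq I) (F : I -> regop E) (x : E) :
  (\sum_(i <- r) F i) x = \sum_(i <- r) F i x.
Proof. exact: (big_morph (fun T : regop E => T x)). Qed.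

Lemma nondecreasing_regop_apply S (x : E) : nondecreasing_seq S -> 0 <= x ->
  nondecreasing_seq (fun N => S N x).
Proof. by move=> ndS x0 m n /ndS /regop_leP; apply. Qed.

(** The order of operators is that of their restrictions to the cone, so least
    upper bounds may be tested one cone vector at a time. *)
Lemma supremums_regop S (T : regop E) :
  (forall x : E, 0 <= x -> supremums (range (fun N => S N x)) (T x)) ->
  supremums (range S) T.
Proof.
move=> ST; split=> [_ [N _ <-]|U SU]; apply/regop_leP => x /[dup] x0 /ST[ub lb].
- by apply: ub; exists N.
- apply: lb => _ [N _ <-].
  by have /regop_leP := SU _ (ex_intro2 _ _ N I erefl); apply.
Qed.

(** The converse of [supremums_regop] rests on constructing a competitor: the
    pointwise suprema on the cone extend to a regular operator above all [S N],
    so the supremum [T] cannot exceed them. *)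
Lemma regop_supremums_apply S (T : regop E) : dedekind_complete E ->
  nondecreasing_seq S -> supremums (range S) T ->
  forall x : E, 0 <= x -> supremums (range (fun N => S N x)) (T x).
Proof.
move=> dcE ndS [ubT lbT].
have ST N (x : E) : 0 <= x -> S N x <= T x.
  by move: x; apply/regop_leP; apply: ubT; exists N.
pose sigma (x : E) := xget (0 : E) (supremums (range (fun N => S N x))).
have sigmaP (x : E) : 0 <= x -> supremums (range (fun N => S N x)) (sigma x).
  move=> x0; have [] := dcE (range (fun N => S N x)).
  - by exists (S 0 x), 0.
  - by exists (T x) => _ [N _ <-]; exact: ST.
  - by move=> s /xgetI; apply.
have nd (x : E) : 0 <= x -> nondecreasing_seq (fun N => S N x).
  exact: nondecreasing_regop_apply.
have sigma_unique (x y : E) : 0 <= x ->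
    supremums (range (fun N => S N x)) y -> sigma x = y.
  move=> x0 [uy ly]; have [ux lx] := sigmaP x x0.
  by apply/le_anti; rewrite lx// ly.
have sigmaD (x y : E) : 0 <= x -> 0 <= y -> sigma (x + y) = sigma x + sigma y.
  move=> x0 y0; apply: sigma_unique; first exact: bl_addr_ge0.
  under eq_fun do rewrite linearD.
  by apply: supremumsD; [exact: nd|exact: nd|exact: sigmaP|exact: sigmaP].
have sigmaZ (c : R) (x : E) : 0 <= c -> 0 <= x -> sigma (c *: x) = c *: sigma x.
  move=> c0 x0; apply: sigma_unique; first exact: bl_scaler_ge0.
  under eq_fun do rewrite linearZ.
  by apply: supremumsZ => //; exact: sigmaP.
pose V := cone_extension sigma.
have V_ge0 (x : E) : 0 <= x -> V x = sigma x by exact: cone_extension_ge0.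
(* V itself need not be positive, but it lies above the regular operator S 0 *)
have VS0_pos : positive_op (V - S 0).
  split=> [c x y|x x0].
    rewrite !fctE /V (cone_extension_linear sigmaD sigmaZ) regop_linear.
    by rewrite addrACA -scalerDr.
  change (0 <= V x - S 0 x); rewrite bl_subr_ge0 V_ge0//.
  by apply: (sigmaP x x0).1; exists 0.
have V_reg : V \in regular_op.
  rewrite -[V](subrK (regop_fun (S 0))); apply: rpredD (regop_funP (S 0)).
  apply/mem_set; exists (V - S 0), 0; rewrite subr0.
  by split=> //; exact: positive_op0.
have TV : T <= RegOp V_reg.
  apply: lbT => _ [N _ <-]; apply/regop_leP => x x0 /=.
  by rewrite V_ge0//; apply: (sigmaP x x0).1; exists N.
move=> x x0; have -> : T x = sigma x; last exact: sigmaP.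
apply/le_anti; rewrite -{1}V_ge0//.
have /regop_leP/(_ x x0) /= -> := TV.
by apply: (sigmaP x x0).2 => _ [N _ <-]; exact: ST.
Qed.

End regular_operator_suprema.

(** * Countable additivity in norm and in order *)

Theorem lemma4p3 (R : realType) (X : Type) (Omega : set (set X))
    (Omega_alg : setalgebra Omega)
    (E : banachLatticeType R) (E_dc : dedekind_complete E)
    (mu : set X -> regop E)
    (mu_ge0 : forall A, Omega A -> 0 <= mu A)
    (mu0 : mu set0 = 0)
    (Delta : nat -> set X) (Delta_Omega : forall n, Omega (Delta n))
    (bigcup_Delta_Omega : Omega (\bigcup_n Delta n)) :
  ((forall x : E,
      series (fun n => mu (Delta n) x) @ \oo --> mu (\bigcup_n Delta n) x) ->
   supremums (range (fun N : nat => \sum_(0 <= n < N.+1) mu (Delta n)))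
     (mu (\bigcup_n Delta n)))
  /\
  (supremums (range (fun N : nat => \sum_(0 <= n < N.+1) mu (Delta n)))
     (mu (\bigcup_n Delta n)) ->
   sigma_order_continuous_norm E ->
   forall x : E,
     series (fun n => mu (Delta n) x) @ \oo --> mu (\bigcup_n Delta n) x).
Proof.
set S := fun N : nat => \sum_(0 <= n < N.+1) mu (Delta n).
set T := mu (\bigcup_n Delta n).
have ndS : nondecreasing_seq S.
  apply/nondecreasing_seqP => N; apply/regop_leP => x x0.
  rewrite /S [in leRHS]big_nat_recr//= -bl_subr_ge0.
  rewrite [_ + _ - _]addrAC subrr add0r.
  by have /regop_ge0P[_] := mu_ge0 _ (Delta_Omega N.+1); apply.
(* S N x is the partial sum of index N.+1, so limits agree up to a shift *)
have seriesE x : (fun N => series (fun n => mu (Delta n) x) N.+1) =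
    (fun N => S N x).
  by apply/funext => N; rewrite /series/= /S regop_sum_apply.
split=> [cvgT|supT ocE x].
- apply: supremums_regop => x x0; apply: cvg_supremums.
    exact: nondecreasing_regop_apply.
  by rewrite -seriesE; move: (cvgT x); rewrite -cvg_shiftS.
- rewrite -cvg_shiftS seriesE.
  have cvg_pos (y : E) : 0 <= y -> (fun N => S N y) @ \oo --> T y.
    move=> y0; apply: supremums_cvg => //.
      exact: nondecreasing_regop_apply.
    exact: regop_supremums_apply.
  have [[p q] /= [p0 q0 ->]] := bl_ge0_decomp x.
  rewrite linearB; under eq_fun do rewrite linearB.
  by apply: cvgB; exact: cvg_pos.
Qed.
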